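(* Let $s\ge 2$, $1\le d\le s$ and $1\le r\le\binom{s}{d}$ be integers with $2d+r-2<s$. Then $$d_r(C_d^{\mathbb{P}})=(q-2)^{d-1}(q-1)^{s-d-r}\left[(q-1)^r-1\right].$$
   Context: $K=\mathbb{F}_q$ is the finite field with $q$ elements, $q$ a power of a prime, and $S=K[t_1,\dots,t_s]$. $KV_d$ is the $K$-span of the square-free monomials of degree $d$ in $S$, i.e. monomials $t_1^{a_1}\cdots t_s^{a_s}$ with all $a_i\in\{0,1\}$ and $\sum a_i=d$. The projective torus $\mathbb{T}$ is the image of $(\mathbb{F}_q^* )^s$ in projective space $\mathbb{P}^{s-1}$ over $K$; its points are represented by the vectors with first entry $1$, so $\mathbb{T}=\{1\}\times(\mathbb{F}_q^* )^{s-1}=\{Q_1,\dots,Q_{\bar m}\}$, $\bar m=(q-1)^{s-1}$. The projective toric code $C_d^{\mathbb{P}}$ (over the $d$-th hypersimplex) is the image of $KV_d\to\mathbb{F}_q^{\bar m}$, $g\mapsto(g(Q_1),\dots,g(Q_{\bar m}))$. $V_{\mathbb{T}}(H)$ denotes the set of common zeros in $\mathbb{T}$ of the polynomials in $H$. For $1\le r\le\dim_K KV_d$, the $r$-th generalized Hamming weight of $C_d^{\mathbb{P}}$ is $$d_r(C_d^{\mathbb{P}}):=\min\{|\mathbb{T}\setminus V_{\mathbb{T}}(H)| : H=\{f_1,\dots,f_r\}\subseteq KV_d \text{ linearly independent over } K\}.$$ (For $q\ge3$ this is the usual $r$-th generalized Hamming weight, i.e. the minimum support size of an $r$-dimensional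 subcode.) *)

(* Defs.v *)
From HB Require Import structures.
From mathcomp Require Import all_boot all_order all_algebra.
From mathcomp Require Import mpoly.

Set Implicit Arguments.
Unset Strict Implicit.
Unset Printing Implicit Defensive.

Import GRing.Theory.
Local Open Scope ring_scope.

Definition squarefree_monomial (s d : nat) (m : 'X_{1..s}) : bool :=
  [forall i, m i <= 1]%N && (mdeg m == d).

(* The index type [bmultinom s d.+1] of monomials of degree < d.+1 is there to
   make the sum finite; it contains every monomial of degree d. *)
Definition in_KV (K : finFieldType) (s d : nat) (p : {mpoly K[s]}) : Prop :=
  exists c : 'X_{1..s < d.+1} -> K,
    p = \sum_(m : 'X_{1..s < d.+1} | squarefree_monomial d m) c m *: 'X_[m].

Definition lin_indep (K : finFieldType) (s r : nat)
    (f : 'I_r -> {mpoly K[s]}) : Prop :=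
  forall c : 'I_r -> K, \sum_(i < r) c i *: f i = 0 -> forall i, c i = 0.

(* Each projective point is represented by its vector with first entry 1. *)
Definition proj_torus (K : finFieldType) (s : nat) : {set {ffun 'I_s -> K}} :=
  [set x : {ffun 'I_s -> K} |
     [forall i, (x i != 0) && ((val i == 0%N) ==> (x i == 1))]].

Definition torus_zeros (K : finFieldType) (s r : nat)
    (f : 'I_r -> {mpoly K[s]}) : {set {ffun 'I_s -> K}} :=
  [set x in proj_torus K s | [forall i, (f i).@[x] == 0]].

Definition is_min (P : nat -> Prop) (w : nat) : Prop :=
  P w /\ forall v, P v -> (w <= v)%N.

(* [is_ghw K s d r w] reads "d_r(C_d) = w", where C_d is the projective toric
   code over the d-th hypersimplex; H = {f_0, ..., f_(r-1)}. *)
Definition is_ghw (K : finFieldType) (s d r w : nat) : Prop :=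
  is_min (fun v => exists f : 'I_r -> {mpoly K[s]},
            [/\ forall i, in_KV d (f i),
                lin_indep f
              & v = #|proj_torus K s :\: torus_zeros f|]) w.

(* Main.v *)
(* Put Q = q - 1.  Lower bound: by homogeneity the nonzeros in the projective
   torus are 1/Q times those in the affine torus (K^* )^s, and the latter are at
   least as many as the exponents in [0, Q-1]^s divisible by the leading
   monomial of some nonzero polynomial in the span of H (footprint bound).  The
   span has at least r leading monomials, corresponding to distinct d-sets; the
   (k+1)-st of these sets contributes at least (Q-1)^d Q^(s-d-k) exponents not
   counted before, and these numbers add up to Q times the claimed value.
   Equality: f_j = (t_{d+1} - t_1) ... (t_{2d-1} - t_{d-1}) (t_{2d-1+j} - t_d),
   1 <= j <= r, which needs exactly 2d + r - 1 <= s variables. *)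
Require Import Defs.
From mathcomp Require Import all_boot all_order all_algebra.
From mathcomp Require Import all_fingroup all_solvable all_field.
From mathcomp Require Import mpoly.
From mathcomp Require Import zify ring.

Set Implicit Arguments.
Unset Strict Implicit.
Unset Printing Implicit Defensive.

Import Order.TTheory GRing.Theory.
Local Open Scope ring_scope.

(** * Rank bound from linear independence *)

(** A matrix with trivial left kernel has as many rows as its rank, hence at most as many as its
    columns. This serves twice: for values at points and for coefficients at leading monomials. *)
Lemma leq_card_lin_indep (K : fieldType) (A B : finType) (M : A -> B -> K) :
  (forall c : A -> K,
     (forall b, \sum_a c a * M a b = 0) -> forall a, c a = 0) ->
  (#|A| <= #|B|)%N.
Proof.
move=> indep.
pose N := \matrix_(i < #|A|, j < #|B|) M (enum_val i) (enum_val j).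
suff /eqP <- : row_free N by apply: rank_leq_col.
apply: inj_row_free => v vN0; apply/rowP => i; rewrite mxE.
have c0 : forall a, v 0 (enum_rank a) = 0.
  apply: indep => b.
  have := congr1 (fun w : 'rV_#|B| => w 0 (enum_rank b)) vN0.
  rewrite !mxE; apply: etrans; rewrite (reindex (fun j : 'I_#|A| => enum_val j)) /=; last first.
    by apply: onW_bij; apply: enum_val_bij.
  by apply: eq_bigr => j _; rewrite mxE enum_valK enum_rankK.
by rewrite -[i]enum_valK c0.
Qed.

(** * Power sums over the units and nonvanishing on the torus *)

Lemma finField_card_eq0 (K : finFieldType) : #|K|%:R = 0 :> K.
Proof.
by rewrite -[LHS]FinRing.zmodXgE -cardsT (expg_cardG (G := [set: K]%G)) ?inE.
Qed.

Lemma finField_expf_pred (K : finFieldType) (x : K) :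
  x != 0 -> x ^+ #|K|.-1 = 1.
Proof.
move=> nz_x; apply: (mulfI nz_x); rewrite mulr1 -exprS prednK ?expf_card //.
by apply/card_gt0P; exists 0.
Qed.

Lemma sum_expr_units_dvd (K : finFieldType) (k : nat) :
  (#|K|.-1 %| k)%N -> \sum_(x : K | x != 0) x ^+ k = -1.
Proof.
case/dvdnP => j ->.
rewrite (eq_bigr (fun=> 1)) => [|x nz_x]; last first.
  by rewrite mulnC exprM finField_expf_pred // expr1n.
rewrite sumr_const cardC1; apply/eqP; rewrite -addr_eq0 -mulrSr prednK.
  by rewrite finField_card_eq0.
by apply/card_gt0P; exists 0.
Qed.

(** Modulo [#|K|.-1] the exponent becomes some [l] with [0 < l < #|K|.-1], and [y ^+ l = 1] has at
    most [l] solutions, fewer than there are units. *)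
Lemma exists_expr_neq1 (K : finFieldType) (k : nat) :
  ~~ (#|K|.-1 %| k)%N -> exists2 y : K, y != 0 & y ^+ k != 1.
Proof.
move=> ndvd; set l := (k %% #|K|.-1)%N.
have Q_gt0 : (0 < #|K|.-1)%N by rewrite -subn1 subn_gt0 finNzRing_gt1.
have l_gt0 : (0 < l)%N by rewrite lt0n.
suff /exists_inP[y nz_y y_l] : [exists y : K in predC1 0, y ^+ l != 1].
  exists y => //; rewrite (divn_eq k #|K|.-1) exprD mulnC exprM.
  by rewrite finField_expf_pred // expr1n mul1r.
apply: contraLR (ltn_pmod k Q_gt0) => /exists_inPn all1.
rewrite -leqNgt -/l (leq_trans (n := size (enum (predC1 (0 : K))))) //.
  by rewrite -cardE cardC1.
apply: (max_unity_roots l_gt0); last exact: enum_uniq.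
by apply/allP => y; rewrite mem_enum => /all1; rewrite negbK unity_rootE.
Qed.

(** Multiplication by a unit [y] permutes the units and scales the sum by [y ^+ k]; choose [y] with
    [y ^+ k != 1]. *)
Lemma sum_expr_units_ndvd (K : finFieldType) (k : nat) :
  ~~ (#|K|.-1 %| k)%N -> \sum_(x : K | x != 0) x ^+ k = 0.
Proof.
case/exists_expr_neq1 => y nz_y y_k; set S := \sum_(x | _) _.
suff /eqP : S = y ^+ k * S.
  rewrite -subr_eq0 -{1}[S]mul1r -mulrBl mulf_eq0 subr_eq0 eq_sym.
  by rewrite (negPf y_k) => /eqP.
rewrite {1}/S (reindex_inj (mulfI nz_y)) /= mulr_sumr.
by apply: eq_big => [x|x _]; rewrite ?mulf_eq0 ?(negPf nz_y) // exprMn.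
Qed.

(* The functional [p |-> \sum_x p(x) / x ^ (mlead p)] over the torus sees, up
   to sign, only the leading coefficient: a monomial [m] contributes only if
   [m = mlead p] modulo [#|K| - 1], which forces [mlead p <= m] entrywise. *)
Lemma mlead_box_nonvanishing (K : finFieldType) (n : nat) (p : {mpoly K[n]}) :
  p != 0 -> (forall i, mlead p i < #|K|.-1)%N ->
  exists2 x : {ffun 'I_n -> K}, (forall i, x i != 0) & p.@[x] != 0.
Proof.
move=> nz_p box; set Q := #|K|.-1 in box.
pose T := [pred x : {ffun 'I_n -> K} | [forall i, x i != 0]].
suff /exists_inP[x /forallP xT px] : [exists x in T, p.@[x] != 0] by exists x.
(* On units [x ^+ Q = 1], so the exponent [Q - mlead p i] plays the role of [- mlead p i]. *)
have : \sum_(x in T) p.@[x] * \prod_i x i ^+ (Q - mlead p i) != 0.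
  have -> : \sum_(x in T) p.@[x] * \prod_i x i ^+ (Q - mlead p i)
     = \sum_(m <- msupp p) p@_m *
         \prod_i \sum_(y : K | y != 0) y ^+ (m i + (Q - mlead p i)).
    under eq_bigr do rewrite mevalE mulr_suml.
    rewrite exchange_big /=; apply: eq_bigr => m _.
    rewrite bigA_distr_big mulr_sumr.
    apply: eq_big => [x|x _]; first by rewrite inE.
    rewrite -mulrA -big_split /=; congr (_ * _).
    by apply: eq_bigr => i _; rewrite exprD.
  rewrite (bigD1_seq (mlead p)) ?mlead_supp ?msupp_uniq //=.
  rewrite [X in _ + X]big1_seq ?addr0.
    rewrite mulf_neq0 ?mleadc_eq0 //; apply/prodf_neq0 => i _.
    by rewrite sum_expr_units_dvd ?oppr_eq0 ?oner_eq0 // subnKC // ltnW.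
  move=> m /andP[neq_m m_p].
  suff [i ndvd] : exists i, ~~ (Q %| m i + (Q - mlead p i))%N.
    by rewrite (bigD1 i) //= sum_expr_units_ndvd // mul0r mulr0.
  apply/existsP; apply: contraNT neq_m => /existsPn dvd.
  have le_m : (mlead p <= m)%MM.
    (* If [m i < mlead p i], then [m i + (Q - mlead p i)] lies strictly between 0 and [Q], so [Q]
       cannot divide it. *)
    apply/mnm_lepP => i; rewrite leqNgt; apply/negP => lt_mi.
    have /dvdn_leq := negbNE (dvd i); have := box i; move: lt_mi.
    set a := m i; set b := mlead p i => lt_ab lt_bQ.
    have gt0 : (0 < a + (Q - b))%N by rewrite addn_gt0 subn_gt0 lt_bQ orbT.
    by move/(_ gt0); rewrite -{1}(subnKC (ltnW lt_bQ)) leq_add2r leqNgt lt_ab.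
  by rewrite eq_le (lem_leo le_m) (msupp_le_mlead m_p).
apply: contraNT => /exists_inPn p0.
by apply/eqP; apply: big1 => x /p0; rewrite negbK => /eqP->; rewrite mul0r.
Qed.

(** * The footprint bound on the torus *)

Lemma mpolyX_neq0 (R : nzRingType) (n : nat) (m : 'X_{1..n}) :
  'X_[m] != 0 :> {mpoly R[n]}.
Proof. by rewrite -msupp_eq0 msuppX. Qed.

(** Each counted exponent [a] is the leading monomial of a monomial multiple [phi a] of some [g i].
    A nontrivial combination of the [phi a] has its leading monomial in the box, so it is nonzero at
    a torus point, where some [g i] is nonzero too. Hence the [phi a] are independent as functions
    on [Y]. *)
Lemma footprint_torus (K : finFieldType) (n : nat) (I : finType)
    (g : I -> {mpoly K[n]}) :
  (#|[set a : {ffun 'I_n -> 'I_#|K|.-1} | [exists i,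
        (g i != 0)%R && (mlead (g i) <= [multinom val (a j) | j < n])%MM]]|
   <= #|[set x : {ffun 'I_n -> K} |
        [forall j, x j != 0]%R && [exists i, (g i).@[x] != 0]%R]|)%N.
Proof.
set B := [set a | _]; set Y := [set x | _].
pose e (a : {ffun 'I_n -> 'I_#|K|.-1}) := [multinom val (a j) | j < n].
have inj_e : injective e.
  move=> a b /mnmP eq_ab; apply/ffunP => j; apply: val_inj.
  by have := eq_ab j; rewrite !mnmE.
pose A : finType := {a | a \in B}.
pose lead_dvd (a : A) i := (g i != 0) && (mlead (g i) <= e (val a))%MM.
have [sel selP] : exists sel : A -> I, forall a, lead_dvd a (sel a).
  apply: (@fin_all_exists A (fun=> I) lead_dvd) => a.
  by have := valP a; rewrite inE => /existsP.
pose phi a := g (sel a) * 'X_[e (val a) - mlead (g (sel a))].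
have nz_phi a : phi a != 0.
  by have /andP[? _] := selP a; rewrite mulf_neq0 ?mpolyX_neq0.
have lead_phi a : mlead (phi a) = e (val a).
  have /andP[? ?] := selP a.
  by rewrite mleadM ?mpolyX_neq0 // mleadXm addmC submK.
pose Z : finType := {x | x \in Y}.
have <- : #|A| = #|B| by rewrite card_sig; apply: eq_card => a; rewrite inE.
have <- : #|Z| = #|Y| by rewrite card_sig; apply: eq_card => a; rewrite inE.
apply: (@leq_card_lin_indep K A Z (fun a x => (phi a).@[val x])) => c c_Y a1.
apply/eqP; apply: contraT => nz_c1.
(* Among the exponents with nonzero coefficient take the largest in the monomial order: no other
   term can cancel it. *)
case: (@arg_maxP _ _ _ a1 (fun a => c a != 0) (fun a => e (val a)) nz_c1).
move=> a nz_ca max_a {a1 nz_c1}.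
have a_max b : c b != 0 -> (e (val b) <= e (val a))%O := max_a b.
pose P := \sum_b c b *: phi b.
have P_a : P@_(e (val a)) = c a * (phi a)@_(e (val a)).
  rewrite raddf_sum (bigD1 a) //= mcoeffZ big1 ?addr0 // => b neq_ba.
  rewrite mcoeffZ; have [->|nz_cb] := eqVneq (c b) 0; first by rewrite mul0r.
  rewrite (mcoeff_gt_mlead (p := phi b)) ?mulr0 // lead_phi lt_neqAle.
  by rewrite (inj_eq inj_e) (inj_eq val_inj) neq_ba a_max.
have nz_Pa : P@_(e (val a)) != 0.
  by rewrite P_a mulf_neq0 // -lead_phi mleadc_eq0.
have nz_P : P != 0 by apply: contraNneq nz_Pa => ->; rewrite mcoeff0.
have lead_P : mlead P = e (val a).
  apply/le_anti; rewrite [X in _ && X]msupp_le_mlead ?mcoeff_msupp // andbT.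
  apply: (le_trans (mlead_sum_le _ _ _)); apply/joinsP => b _.
  have [->|nz_cb] := eqVneq (c b) 0; first by rewrite scale0r mlead0 le0x.
  by rewrite mleadZ // lead_phi a_max.
have [|x x_T] := mlead_box_nonvanishing nz_P.
  by move=> i; rewrite lead_P mnmE; apply: ltn_ord.
have P_x : P.@[x] = \sum_b c b * (phi b).@[x].
  by rewrite raddf_sum; apply: eq_bigr => b _ /=; rewrite mevalZ.
have [xY|xNY] := boolP (x \in Y).
  by rewrite P_x (c_Y (Sub x xY)) eqxx.
rewrite P_x big1 ?eqxx // => b _; rewrite mevalM.
suff -> : (g (sel b)).@[x] = 0 by rewrite mul0r mulr0.
apply/eqP; apply: contraNT xNY => nz_gx; rewrite inE.
by apply/andP; split; [apply/forallP | apply/existsP; exists (sel b)].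
Qed.

(** * Counting exponents above a family of sets *)

Lemma card_family_set (n : nat) (T : finType) (F : 'I_n -> {set T}) :
  #|[set a : {ffun 'I_n -> T} | [forall i, a i \in F i]]| = (\prod_i #|F i|)%N.
Proof.
transitivity #|family F|.
  by apply: eq_card => a; rewrite inE; apply/forallP/familyP.
by rewrite card_family foldrE big_map big_enum.
Qed.

(* Adding a [d]-set [h] to the family [L'] contributes at least the functions
   that are positive on [h] and vanish at one chosen point of [h' :\: h] for
   each [h'] in [L']. *)
Lemma card_upset_lower_bound (n Q d : nat) (L : {set {set 'I_n}}) :
  (0 < Q)%N -> (forall h, h \in L -> #|h| = d) ->
  (\sum_(k < #|L|) Q.-1 ^ d * Q ^ (n - d - k)
   <= #|[set a : {ffun 'I_n -> 'I_Q} |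
          [exists h in L, [forall i in h, 0 < a i]]]|)%N.
Proof.
move=> Q_gt0 card_L; move: {2}#|L| (erefl #|L|) => r Lr.
elim: r L Lr card_L => [|r IHr] L Lr card_L; first by rewrite Lr big_ord0.
have [h hL] : exists h, h \in L by apply/card_gt0P; rewrite Lr.
have hd := card_L _ hL; pose L' := L :\ h.
have L'r : #|L'| = r by apply: succn_inj; rewrite -Lr (cardsD1 h L) hL.
have L'L h' : h' \in L' -> h' \in L by case/setD1P.
have := IHr _ L'r (fun h' h'L' => card_L _ (L'L h' h'L')).
rewrite Lr L'r big_ord_recr /=; set U' := [set a | _]; set U := [set a | _].
move=> U'_ge.
(* The pick never fails for [h'] in [L']: a set of the same size as [h] and contained in it would be
   [h] itself. *)
pose b (h' : {set 'I_n}) := [pick i in h' :\: h].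
pose C := [set i | Some i \in b @: L'].
have C_le : (#|C| <= r)%N.
  rewrite -L'r -(card_imset _ (@Some_inj _)).
  apply: leq_trans (leq_imset_card b L'); apply: subset_leq_card.
  by apply/subsetP => _ /imsetP[i iC ->]; move: iC; rewrite inE.
have C_meets h' : h' \in L' -> exists2 i, i \in C & i \in h'.
  move=> h'L'; case b_h': (b h') => [i|]; move: (b_h'); rewrite {1}/b.
    case: pickP => // j; rewrite inE => /andP[_ j_h'] [eq_ji]; exists j => //.
    by rewrite inE eq_ji -b_h'; apply: imset_f.
  case: pickP => // none _; have [neq_h' _] := setD1P h'L'.
  case/negP: neq_h'; rewrite eqEcard hd card_L ?L'L // leqnn andbT.
  by rewrite -setD_eq0; apply/eqP/setP => i; rewrite none inE.
have C_h i : i \in C -> i \notin h.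
  rewrite inE => /imsetP[h' _]; rewrite /b; case: pickP => // j.
  by rewrite inE => /andP[? _] [->].
pose F i : {set 'I_Q} :=
  if i \in h then [set v : 'I_Q | (0 < v)%N]
  else if i \in C then [set v : 'I_Q | val v == 0%N] else setT.
pose V := [set a : {ffun 'I_n -> 'I_Q} | [forall i, a i \in F i]].
have V_U : V \subset U.
  apply/subsetP => a; rewrite !inE => /forallP aF; apply/existsP; exists h.
  rewrite hL; apply/forall_inP => i ih.
  by have := aF i; rewrite /F ih inE.
have U'_U : U' \subset U.
  apply/subsetP => a; rewrite !inE => /exists_inP[h' h'L' a_h'].
  by apply/exists_inP; exists h' => //; apply: L'L.
(* A member of [U'] is positive on some [h'], which meets [C], where members of [V] vanish. *)
have U'V : U' :&: V = set0.
  apply/eqP; rewrite -subset0; apply/subsetP => a; rewrite !inE.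
  case/andP => /exists_inP[h' /C_meets[i iC ih'] /forall_inP/(_ i ih')].
  move=> a_gt0 /forallP/(_ i); rewrite /F (negPf (C_h i iC)) iC inE.
  by rewrite -leqn0 leqNgt a_gt0.
have card_V : #|V| = (Q.-1 ^ d * Q ^ (n - d - #|C|))%N.
  have card_pos : #|[set v : 'I_Q | (0 < v)%N]| = Q.-1.
    case: Q Q_gt0 {F V V_U IHr U' U U'_ge U'_U U'V} => // Q' _.
    rewrite -[Q'.+1 in RHS]card_ord -(cardC1 ord0).
    by apply: eq_card => v; rewrite !inE lt0n.
  have card_zero : #|[set v : 'I_Q | val v == 0%N]| = 1%N.
    by rewrite -(cards1 (Ordinal Q_gt0)); apply: eq_card => v; rewrite !inE.
  rewrite card_family_set (bigID (mem h)) /=.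
  rewrite (eq_bigr (fun=> Q.-1)) => [|i ih]; last by rewrite /F ih.
  rewrite prod_nat_const hd; congr (_ * _)%N.
  rewrite (bigID (mem C)) /= big1 ?mul1n => [|i /andP[ih iC]]; last first.
    by rewrite /F (negPf ih) iC.
  rewrite (eq_bigr (fun=> Q)) => [|i /andP[ih iC]]; last first.
    by rewrite /F (negPf ih) (negPf iC) cardsT card_ord.
  rewrite prod_nat_const; congr (_ ^ _)%N.
  have hC : h :&: C = set0.
    apply/setP => i; rewrite in_set0 in_setI andbC.
    by case: (boolP (i \in C)) => // /C_h /negbTE.
  rewrite -subnDA -{1}hd -[(#|h| + _)%N]subn0 -(cards0 'I_n) -hC -cardsU.
  transitivity #|~: (h :|: C)|; last by rewrite cardsCs setCK card_ord.
  by apply: eq_card => i; rewrite in_setC in_setU negb_or.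
apply: (@leq_trans #|U' :|: V|); last by rewrite subset_leq_card // subUset U'_U.
rewrite cardsU U'V cards0 subn0 leq_add // card_V leq_mul //.
by rewrite leq_pexp2l // leq_sub2l.
Qed.

(** * Square-free forms and the leading monomials of their span *)

Lemma in_KV_msupp (K : finFieldType) (s d : nat) (p : {mpoly K[s]}) m :
  in_KV d p -> p@_m != 0 -> exists2 h : {set 'I_s}, #|h| = d & m = mesym1 h.
Proof.
case=> c ->; rewrite raddf_sum => nz_m.
have /andP[/forallP m_le1 /eqP mdeg_m] : squarefree_monomial d m.
  apply: contraNT nz_m => not_m; apply/eqP; apply: big1 => m' sf_m' /=.
  rewrite mcoeffZ mcoeffX; case: eqP => [eq_m|_]; last by rewrite mulr0.
  by rewrite -eq_m sf_m' in not_m.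
have eq_m : m = mesym1 [set i | m i == 1%N].
  by apply/mnmP => i; rewrite mnmE inE; case: (m i) (m_le1 i) => [|[]].
by exists [set i | m i == 1%N]; rewrite // -mdeg_mesym1 -eq_m.
Qed.

Lemma in_KV_homog (K : finFieldType) (s d : nat) (p : {mpoly K[s]})
    (l : K) (x y : {ffun 'I_s -> K}) :
  in_KV d p -> (forall i, y i = l * x i) -> p.@[y] = l ^+ d * p.@[x].
Proof.
case=> c -> y_lx; rewrite !raddf_sum mulr_sumr; apply: eq_bigr => m /=.
case/andP => _ /eqP mdeg_m; rewrite !mevalZ !mevalX mulrCA; congr (_ * _).
under eq_bigr do rewrite y_lx exprMn.
by rewrite big_split prodrXr -mdegE mdeg_m.
Qed.

(** The coefficients form a finite function, so that the span is indexed by a finite type, as the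
    footprint bound requires. *)
Definition lincomb (K : finFieldType) (s r : nat) (f : 'I_r -> {mpoly K[s]})
  (c : {ffun 'I_r -> K}) : {mpoly K[s]} := \sum_i c i *: f i.

Lemma mcoeff_lincomb (K : finFieldType) (s r : nat) (f : 'I_r -> {mpoly K[s]})
    (c : {ffun 'I_r -> K}) m :
  (lincomb f c)@_m = \sum_i c i * (f i)@_m.
Proof. by rewrite raddf_sum; apply: eq_bigr => i _ /=; rewrite mcoeffZ. Qed.

(* For [f] in [KV_d] every leading monomial of the span is square-free, hence
   of the form [mesym1 h]. *)
Definition lead_sets (K : finFieldType) (s r : nat)
    (f : 'I_r -> {mpoly K[s]}) : {set {set 'I_s}} :=
  [set h | [exists c, (lincomb f c != 0) && (mlead (lincomb f c) == mesym1 h)]].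

Lemma card_in_lead_sets (K : finFieldType) (s d r : nat)
    (f : 'I_r -> {mpoly K[s]}) (h : {set 'I_s}) :
  (forall i, in_KV d (f i)) -> h \in lead_sets f -> #|h| = d.
Proof.
move=> f_KV; rewrite inE => /existsP[c /andP[nz_c /eqP lead_c]].
have : (lincomb f c)@_(mesym1 h) != 0 by rewrite -lead_c mleadc_eq0.
rewrite mcoeff_lincomb => nz_h.
have [i nz_i] : exists i, (f i)@_(mesym1 h) != 0.
  apply/existsP; apply: contraNT nz_h => /existsPn all0; apply/eqP.
  by apply: big1 => i _; have := all0 i; rewrite negbK => /eqP->; rewrite mulr0.
by have [h' <- /inj_mesym1->] := in_KV_msupp (f_KV i) nz_i.
Qed.

(** A combination whose coefficients vanish at all leading monomials of the span must be zero, since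
    its own leading monomial is one of them. So the coefficient rows stay independent when
    restricted to these monomials. *)
Lemma leq_card_lead_sets (K : finFieldType) (s d r : nat)
    (f : 'I_r -> {mpoly K[s]}) :
  (forall i, in_KV d (f i)) -> lin_indep f -> (r <= #|lead_sets f|)%N.
Proof.
move=> f_KV f_indep; set L := lead_sets f; pose B : finType := {h | h \in L}.
have <- : #|B| = #|L| by rewrite card_sig; apply: eq_card => h; rewrite inE.
rewrite -{1}[r]card_ord.
apply: (@leq_card_lin_indep K _ B (fun i h => (f i)@_(mesym1 (val h)))) => c c0.
pose c' := [ffun i => c i]; apply: f_indep.
have -> : \sum_i c i *: f i = lincomb f c'.
  by apply: eq_bigr => i _; rewrite ffunE.
apply/eqP; apply: contraT => nz_c.
have nz_lead : (lincomb f c')@_(mlead (lincomb f c')) != 0.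
  by rewrite mleadc_eq0.
have [h lead_h] : exists h : {set 'I_s}, mlead (lincomb f c') = mesym1 h.
  move: nz_lead; rewrite mcoeff_lincomb => nz_lead.
  have [i nz_i] : exists i, (f i)@_(mlead (lincomb f c')) != 0.
    apply/existsP; apply: contraNT nz_lead => /existsPn all0; apply/eqP.
    by apply: big1 => i _; have := all0 i; rewrite negbK => /eqP->; rewrite mulr0.
  by have [h _ ->] := in_KV_msupp (f_KV i) nz_i; exists h.
have hL : h \in L.
  by rewrite inE; apply/existsP; exists c'; rewrite nz_c lead_h eqxx.
case/negP: nz_lead; rewrite lead_h mcoeff_lincomb -[X in _ == X](c0 (Sub h hL)).
by apply/eqP/eq_bigr => i _; rewrite ffunE.
Qed.

(** * The lower bound for the weight *)

Lemma torus_nonzeros_lower_bound (K : finFieldType) (s d r : nat)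
    (f : 'I_r -> {mpoly K[s]}) :
  (forall i, in_KV d (f i)) -> lin_indep f ->
  (\sum_(k < r) #|K|.-1.-1 ^ d * #|K|.-1 ^ (s - d - k)
   <= #|[set x : {ffun 'I_s -> K} |
        [forall j, x j != 0]%R && [exists i, (f i).@[x] != 0]%R]|)%N.
Proof.
move=> f_KV f_indep; set Q := #|K|.-1.
have Q_gt0 : (0 < Q)%N by rewrite /Q -subn1 subn_gt0 finNzRing_gt1.
have card_L h : h \in lead_sets f -> #|h| = d by apply: card_in_lead_sets.
have rL := leq_card_lead_sets f_KV f_indep.
apply: (@leq_trans (\sum_(k < #|lead_sets f|) Q.-1 ^ d * Q ^ (s - d - k))%N).
  rewrite (big_ord_widen _ (fun k => Q.-1 ^ d * Q ^ (s - d - k))%N rL).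
  by rewrite [X in (_ <= X)%N](bigID (fun k : 'I__ => k < r)%N) leq_addr.
apply: (leq_trans (card_upset_lower_bound Q_gt0 card_L)).
(* Positivity of [a] on [h] says that [mesym1 h] divides the monomial with exponent [a]; and where a
   combination is nonzero, some [f i] is nonzero. *)
apply: leq_trans (leq_trans (footprint_torus (lincomb f)) _).
  apply: subset_leq_card; apply/subsetP => a; rewrite !inE.
  case/exists_inP => h; rewrite inE => /existsP[c /andP[nz_c /eqP lead_c]].
  move=> /forall_inP a_gt0; apply/existsP; exists c; rewrite nz_c lead_c.
  apply/mnm_lepP => i; rewrite !mnmE.
  by case: (boolP (i \in h)) => // /a_gt0.
apply: subset_leq_card; apply/subsetP => x; rewrite !inE => /andP[->].
case/existsP => c; apply: contraNT => /existsPn all0; rewrite raddf_sum /=.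
apply/eqP; apply: big1 => i _; have := all0 i.
by rewrite negbK mevalZ => /eqP->; rewrite mulr0.
Qed.

(** Every affine torus point is its first coordinate times a normalised point, and by homogeneity
    the scaling preserves nonvanishing; so pairs of a unit and a projective nonzero cover the affine
    nonzeros. *)
Lemma card_torus_le_proj (K : finFieldType) (s d r : nat)
    (f : 'I_r -> {mpoly K[s]}) :
  (0 < s)%N -> (forall i, in_KV d (f i)) ->
  (#|[set x : {ffun 'I_s -> K} |
        [forall j, x j != 0]%R && [exists i, (f i).@[x] != 0]%R]|
   <= #|K|.-1 * #|proj_torus K s :\: torus_zeros f|)%N.
Proof.
case: s f => // s f _ f_KV; set T := proj_torus K s.+1 :\: torus_zeros f.
set X := [set x | _].
rewrite -(cardC1 (0 : K)) -(cardsE (predC1 (0 : K))) -cardsX.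
pose scale (u : K * {ffun 'I_s.+1 -> K}) := [ffun i => u.1 * u.2 i].
apply: leq_trans (leq_imset_card scale _); apply: subset_leq_card.
apply/subsetP => x; rewrite inE => /andP[/forallP nz_x /existsP[i nz_fi]].
pose t := [ffun j => (x ord0)^-1 * x j].
apply/imsetP; exists (x ord0, t); last first.
  by apply/ffunP => j; rewrite !ffunE /= mulrA mulfV ?mul1r.
rewrite !inE nz_x /=.
have tP : [forall j, (t j != 0) && ((val j == 0%N) ==> (t j == 1))].
  apply/forallP => j; rewrite ffunE mulf_neq0 ?invr_eq0 ?nz_x //=.
  apply/implyP => j0; have -> : j = ord0 by apply/val_inj/eqP.
  by rewrite mulVf.
rewrite tP andbT /=; apply/forallPn; exists i.
rewrite (in_KV_homog (l := (x ord0)^-1) (x := x) (f_KV i)) => [|j].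
  by rewrite mulf_neq0 // expf_neq0 // invr_eq0.
by rewrite ffunE.
Qed.

Lemma sum_geometric_upset (Q s d r : nat) :
  (0 < Q)%N -> (0 < d)%N -> (d + r <= s)%N ->
  (\sum_(k < r) Q.-1 ^ d * Q ^ (s - d - k)
   = Q * (Q.-1 ^ (d - 1) * Q ^ (s - d - r) * (Q ^ r - 1)))%N.
Proof.
case: d => // d Q_gt0 _ le_s.
(* Reversed, the sum is geometric with increasing powers of [Q]; one factor [Q.-1] turns it into
   [Q ^ r - 1] without any division. *)
rewrite -big_distrr /= (reindex_inj rev_ord_inj) /=.
under eq_bigr => k _.
  have -> : (s - d.+1 - (r - k.+1) = (s - d.+1 - r).+1 + k)%N.
    by have := ltn_ord k; lia.
  rewrite expnD; over.
rewrite -big_distrr /= subn1 subn1 predn_exp expnS [in LHS]expnS /=.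
ring.
Qed.

Lemma ghw_lower_bound (K : finFieldType) (s d r : nat)
    (f : 'I_r -> {mpoly K[s]}) :
  (0 < d)%N -> (d + r <= s)%N ->
  (forall i, in_KV d (f i)) -> lin_indep f ->
  (#|K|.-1.-1 ^ (d - 1) * #|K|.-1 ^ (s - d - r) * (#|K|.-1 ^ r - 1)
    <= #|proj_torus K s :\: torus_zeros f|)%N.
Proof.
move=> d_gt0 le_s f_KV f_indep.
have Q_gt0 : (0 < #|K|.-1)%N by rewrite -subn1 subn_gt0 finNzRing_gt1.
have s_gt0 : (0 < s)%N by lia.
rewrite -(leq_pmul2l Q_gt0) -sum_geometric_upset //.
apply: leq_trans (torus_nonzeros_lower_bound f_KV f_indep) _.
exact: card_torus_le_proj.
Qed.

(** * Products of binomials *)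

Lemma msupp_squarefree_in_KV (K : finFieldType) (s d : nat) (p : {mpoly K[s]}) :
  (forall m, p@_m != 0 -> squarefree_monomial d m) -> in_KV d p.
Proof.
move=> p_sf; exists (fun m => p@_m); apply/mpolyP => m.
rewrite raddf_sum /=; under eq_bigr do rewrite mcoeffZ mcoeffX.
have [p0|nz] := eqVneq p@_m 0.
  rewrite p0 big1 // => m' _; case: eqP => [->|_]; last by rewrite mulr0.
  by rewrite p0 mul0r.
have sf_m := p_sf m nz; have /andP[_ /eqP mdeg_m] := sf_m.
have lt_m : (mdeg m < d.+1)%N by rewrite mdeg_m.
rewrite (bigD1 (BMultinom lt_m)) //= eqxx mulr1 big1 ?addr0 // => m' /andP[_].
by rewrite -val_eqE /= => /negbTE->; rewrite mulr0.
Qed.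

(** Each term of the expansion takes one variable from every factor; distinct factors share no
    variable, so the term is square-free. *)
Lemma prod_binomials_in_KV (K : finFieldType) (s d : nat)
    (w : 'I_d -> bool -> 'I_s) :
  (forall k k' b b', w k b = w k' b' -> k = k') ->
  in_KV d (\prod_k ('X_(w k true) - 'X_(w k false)) : {mpoly K[s]}).
Proof.
move=> w_inj; apply: msupp_squarefree_in_KV => m.
pose F k b : {mpoly K[s]} := (-1) ^+ (~~ b) *: 'X_(w k b).
have -> : \prod_k ('X_(w k true) - 'X_(w k false)) = \prod_k \sum_b F k b.
  by apply: eq_bigr => k _; rewrite big_bool /F /= scale1r scaleN1r.
rewrite bigA_distr_bigA raddf_sum /= => nz_m.
pose U (g : {ffun 'I_d -> bool}) := (\sum_k U_(w k (g k)))%MM.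
have F_X (g : {ffun 'I_d -> bool}) : \prod_k F k (g k) = (\prod_k (-1) ^+ (~~ g k)) *: 'X_[U g].
  by rewrite scaler_prod mprodXE.
have [g ->] : exists g : {ffun 'I_d -> bool}, m = U g.
  apply: (exists_eqP (f1 := fun=> m) (f2 := U)).
  apply: contraNT nz_m => /existsPn m_U; apply/eqP.
  apply: big1 => g _; rewrite F_X mcoeffZ mcoeffX eq_sym.
  by rewrite (negPf (m_U g)) mulr0.
apply/andP; split; last first.
  rewrite mdeg_sum (eq_bigr (fun=> 1%N)) => [|k _]; last by rewrite mdeg1.
  by rewrite sum1_card card_ord.
apply/forallP => i; rewrite mnm_sumE.
have [/existsP[k /eqP wk]|/existsPn none] :=
  boolP [exists k, w k (g k) == i]; last first.
  by rewrite big1 // => k _; rewrite mnmE (negPf (none k)).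
rewrite (bigD1 k) //= big1 ?addn0 => [|k' neq_k']; first by rewrite mnmE leq_b1.
rewrite mnmE; case: eqP => // wk'; case/eqP: neq_k'.
by apply: w_inj (etrans wk' (esym wk)).
Qed.

Lemma prod_piecewise (n a b c e w0 w1 w2 w3 w4 : nat) :
  n = (1 + a + b + c + e)%N ->
  (\prod_(i < n) (if i < 1 then w0 else if i < 1 + a then w1 else
     if i < 1 + a + b then w2 else if i < 1 + a + b + c then w3 else w4)
   = w0 * w1 ^ a * w2 ^ b * w3 ^ c * w4 ^ e)%N.
Proof.
move=> ->; rewrite !big_split_ord /= big_ord1 /=; congr (_ * _ * _ * _ * _)%N.
- rewrite (eq_bigr (fun=> w1)) ?prod_nat_const ?card_ord // => i _.
  by have := ltn_ord i; do ![case: ifP]; lia.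
- rewrite (eq_bigr (fun=> w2)) ?prod_nat_const ?card_ord // => i _.
  by have := ltn_ord i; do ![case: ifP]; lia.
- rewrite (eq_bigr (fun=> w3)) ?prod_nat_const ?card_ord // => i _.
  by have := ltn_ord i; do ![case: ifP]; lia.
- rewrite (eq_bigr (fun=> w4)) ?prod_nat_const ?card_ord // => i _.
  by do ![case: ifP]; lia.
Qed.

(** * The extremal family and its nonzeros *)

Section ExtremalFamily.

Variables (K : finFieldType) (s d r : nat).
(** Both parameters are shifted by one: for [s.+1] variables and degree [d.+1] this is exactly the
    condition [2 * d + r - 2 < s] of the theorem. *)
Hypothesis le_s : (d + d + r <= s)%N.

Let Q := #|K|.-1.

(* The factors of the [j]-th polynomial are ['X_(tip j k) - 'X_(base k)];
   here [d] stands for the degree minus one. *)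
Definition base (k : 'I_d.+1) : 'I_s.+1 := inord k.
Definition tip (j : 'I_r) (k : 'I_d.+1) : 'I_s.+1 :=
  inord (if (k < d)%N then d.+1 + k else d.+1 + d + j)%N.

Definition extremal (j : 'I_r) : {mpoly K[s.+1]} :=
  \prod_k ('X_(tip j k) - 'X_(base k)).

Lemma val_base k : base k = k :> nat.
Proof. by rewrite inordK //; have := ltn_ord k; lia. Qed.

Lemma val_tip j k :
  tip j k = (if (k < d)%N then d.+1 + k else d.+1 + d + j)%N :> nat.
Proof.
by rewrite inordK //; have := ltn_ord k; have := ltn_ord j; case: ifP; lia.
Qed.

Lemma meval_extremal j (x : 'I_s.+1 -> K) :
  (extremal j).@[x] = \prod_k (x (tip j k) - x (base k)).
Proof.
rewrite rmorph_prod; apply: eq_bigr => k _ /=.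
by rewrite mevalB !mevalXU.
Qed.

Lemma extremal_in_KV j : in_KV d.+1 (extremal j).
Proof.
apply: (@prod_binomials_in_KV _ _ _ (fun k b => if b then tip j k else base k)).
move=> k k' b b' /(congr1 val) /= eq_w; apply: val_inj; move: eq_w.
have := ltn_ord k; have := ltn_ord k'.
by case: b b' => [] []; rewrite /= ?val_base ?val_tip //; do ?case: ifP; lia.
Qed.

Lemma extremal_lin_indep : lin_indep extremal.
Proof.
move=> c c0 j.
(* This point is 0 on the bases, 1 on the shared tips and 1 on the last tip of index [j] only, so it
   separates the [j]-th polynomial from the others. *)
pose x (i : 'I_s.+1) : K :=
  (if i < d.+1 then false else if i < d.+1 + d then true
   else i == d.+1 + d + j :> nat)%N%:R.
have ext_x i : (extremal i).@[x] = (i == j)%:R.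
  rewrite meval_extremal big_ord_recr /= big1 ?mul1r => [|k _].
    rewrite /x !val_tip !val_base /= ltnn ltnS leqnn subr0.
    rewrite ifF; last by lia.
    by rewrite ifF ?eqn_add2l //; lia.
  rewrite /x !val_tip !val_base /= ltn_ord ifF; last by lia.
  by rewrite ltn_add2l ltn_ord ifT ?subr0 //; have := ltn_ord k; lia.
have := congr1 (meval x) c0; rewrite meval0 raddf_sum /=.
rewrite (bigD1 j) //= mevalZ ext_x eqxx mulr1 big1 ?addr0 // => i neq_ij.
by rewrite mevalZ ext_x (negPf neq_ij) mulr0.
Qed.

(* Dividing the coordinate [d.+1 + k] by the coordinate [minn k d] turns
   the nonvanishing conditions into conditions [y i != 1]. *)
Definition ratios (x : {ffun 'I_s.+1 -> K}) : {ffun 'I_s.+1 -> K} :=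
  [ffun i : 'I_s.+1 => if (i < d.+1)%N then x i
           else x i / x (inord (minn (i - d.+1) d))].

(** All denominators are among the first [d.+1] coordinates, which are left unchanged and are
    nonzero on the torus. *)
Lemma ratios_inj : {in proj_torus K s.+1 &, injective ratios}.
Proof.
move=> x y; rewrite !inE => /forallP xT /forallP yT eq_xy.
have eq_base (i : 'I_s.+1) : (i < d.+1)%N -> x i = y i.
  move=> lt_i; have := congr1 (fun z : {ffun _} => z i) eq_xy.
  by rewrite !ffunE lt_i.
apply/ffunP => i; have [/eq_base //|ge_i] := ltnP i d.+1.
have := congr1 (fun z : {ffun _} => z i) eq_xy.
rewrite !ffunE ltnNge ge_i /= (eq_base (inord _)); last first.
  by rewrite inordK; have := ltn_ord i; lia.
by apply: divIf; have /andP[] := yT (inord (minn (i - d.+1) d)).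
Qed.

(** The blocks are: the normalised coordinate, the other bases, the ratios at the shared tips, the
    ratios at the [r] last tips, and the free coordinates. Some polynomial is nonzero when no shared
    ratio is 1 and the last ratios are not all 1; hence [S] is taken to be the units, then
    [[set 1]], and the counts are subtracted. *)
Definition ratio_range (S : {set K}) (i : 'I_s.+1) : {set K} :=
  if (i < 1)%N then [set 1]
  else if (i < 1 + d)%N then [set~ 0]
  else if (i < 1 + d + d)%N then ~: [set 0; 1]
  else if (i < 1 + d + d + r)%N then S else [set~ 0].

Lemma card_ratio_range (S : {set K}) :
  #|[set y : {ffun 'I_s.+1 -> K} | [forall i, y i \in ratio_range S i]]|
  = (Q ^ d * Q.-1 ^ d * #|S| ^ r * Q ^ (s - d - d - r))%N.
Proof.
rewrite card_family_set.
have := @prod_piecewise s.+1 d d r (s - d - d - r) 1 Q Q.-1 #|S| Q.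
rewrite mul1n => <-; last by lia.
apply: eq_bigr => i _; rewrite /ratio_range.
case: ifP => _; first by rewrite cards1.
case: ifP => _; first by rewrite cardsC1.
case: ifP => _; last by case: ifP => _ //; rewrite cardsC1.
by rewrite cardsCs setCK cards2 eq_sym oner_eq0 /Q subn2.
Qed.

Lemma card_extremal_nonzeros :
  (#|proj_torus K s.+1 :\: torus_zeros extremal|
   <= Q.-1 ^ d * Q ^ (s - d - r) * (Q ^ r - 1))%N.
Proof.
set N := _ :\: _.
pose Y S := [set y : {ffun 'I_s.+1 -> K} |
  [forall i, y i \in ratio_range S i]].
have Y1_Y : Y [set 1] \subset Y [set~ 0].
  apply/subsetP => y; rewrite !inE => /forallP y_in; apply/forallP => i.
  have := y_in i; rewrite /ratio_range; do 4![case: ifP => // _].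
  by rewrite !inE => /eqP->; rewrite oner_eq0.
pose units : {set K} := [set~ 0].
have -> : (Q.-1 ^ d * Q ^ (s - d - r) * (Q ^ r - 1)
           = #|Y units :\: Y [set 1%R]|)%N.
  rewrite cardsD (setIidPr Y1_Y) !card_ratio_range cards1 exp1n cardsC1 -/Q.
  have -> : (s - d - r = d + (s - d - d - r))%N by lia.
  by rewrite expnD mulnBr; congr (_ - _)%N; ring.
have N_T : {subset N <= proj_torus K s.+1} by move=> x; rewrite inE => /andP[].
rewrite -(card_in_imset (f := ratios) (D := mem N)); last first.
  by move=> x y xN yN; apply: ratios_inj; apply: N_T.
apply: subset_leq_card; apply/subsetP => _ /imsetP[x xN ->].
have := N_T x xN; rewrite inE => /forallP xT.
have nz_x i : x i != 0 by have /andP[] := xT i.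
have [j nz_j] : exists j, (extremal j).@[x] != 0.
  apply/existsP; move: xN; rewrite !inE => /andP[].
  by case: (boolP [forall _, _]) => //= _; rewrite negb_forall.
move: nz_j; rewrite meval_extremal => /prodf_neq0 nz_k.
have neq_k k : x (tip j k) != x (base k) by rewrite -subr_eq0 nz_k.
have ratio_neq1 k : ratios x (tip j k) != 1.
  rewrite ffunE val_tip ifF; last by case: ifP; lia.
  apply: contra (neq_k k) => /eqP /divr1_eq ->.
  (* Truncation by [minn _ d] recovers [k]: shared tips have offset [k < d], and the last tip has
     offset [d + j], which is cut to [d]. *)
  apply/eqP; congr (x _); apply: val_inj; rewrite /= val_base inordK.
    by have := ltn_ord k; case: ifP; lia.
  by have := ltn_ord k; have := ltn_ord j; case: ifP; lia.
have nz_ratio i : ratios x i != 0.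
  by rewrite ffunE; case: ifP => _; rewrite ?mulf_neq0 ?invr_eq0.
rewrite !inE; apply/andP; split.
  apply/forallPn; exists (tip j ord_max).
  have val_j : tip j ord_max = (d.+1 + d + j)%N :> nat by rewrite val_tip ltnn.
  rewrite /ratio_range val_j.
  do 2![rewrite ifF; last by lia]; rewrite ifT ?inE ?ratio_neq1 //.
  by have := ltn_ord j; lia.
apply/forallP => i; rewrite /ratio_range.
case: ifP => [i0|_].
  have i_0 : val i = 0%N by move: i0 => /=; lia.
  have /andP[_] := xT i; rewrite i_0 eqxx /= => x_1.
  by rewrite inE ffunE ifT //; lia.
case: ifP => [_|ge_i]; first by rewrite !inE.
case: ifP => [lt_i|_]; last by case: ifP => _; rewrite !inE.
have lt_k : (i - d.+1 < d.+1)%N by lia.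
(* Coordinates of the third block are the shared tips, which are the same for every [j]. *)
have -> : i = tip j (Ordinal lt_k).
  by apply: val_inj; rewrite /= val_tip /=; case: ifP; lia.
by rewrite !inE negb_or nz_ratio ratio_neq1.
Qed.

End ExtremalFamily.

Local Close Scope ring_scope.

Theorem theorem4p1 (K : finFieldType) (s d r : nat)
  (hs : 2 <= s) (hd1 : 1 <= d) (hds : d <= s)
  (hr1 : 1 <= r) (hrs : r <= 'C(s, d))
  (hsdr : 2 * d + r - 2 < s) :
  is_ghw K s d r
    ((#|K| - 2) ^ (d - 1) * (#|K| - 1) ^ (s - d - r) * ((#|K| - 1) ^ r - 1)).
Proof.
have le_s : d + r <= s by lia.
split=> [|v [f [f_KV f_indep ->]]]; last first.
  by rewrite subn2 [#|K| - 1]subn1; apply: ghw_lower_bound.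
case: d s hd1 hds hrs hsdr le_s hs => // d [|s] // _ _ _ hsdr le_s _.
have dds : d + d + r <= s by lia.
have ext_KV j := @extremal_in_KV K _ _ _ dds j.
have ext_indep := @extremal_lin_indep K _ _ _ dds.
(* Only the upper count remains to be supplied, as the lower bound applies to this family too. *)
exists (@extremal K s d r); split=> //; apply/anti_leq.
rewrite subn2 [#|K| - 1]subn1 ghw_lower_bound //=.
by rewrite subn1 subSS; apply: card_extremal_nonzeros.
Qed.
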